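(* Let $A=\{a_k\}_{k\in\mathbb{Z}}$ and $B=\{b_k\}_{k\in\mathbb{Z}}$ be sequences of complex numbers, each being $o(k^{c})$ as $k\to\pm\infty$ for some $c<1$. If $\alpha$ and $\beta$ are positive numbers such that $\alpha\beta=\pi^2$, and $w>0$ with $w\ne n^2\beta$ for every positive integer $n$, then $$\begin{aligned} &\frac{\pi}{2}\cot(\sqrt{w\alpha};A)\coth(\sqrt{w\beta};B)\\ &=\frac{a_0b_0}{2w}+\frac{a_0\beta D^{(B)}(2)-b_0\alpha D^{(A)}(2)}{\pi^2}\\ &\quad+\sum_{n=1}^\infty\left\{\frac{n\alpha\coth(n\alpha;A)}{w+n^2\alpha}b_n+\frac{n\beta\coth(n\beta;B)}{w-n^2\beta}a_n\right\}\\ &\quad+\sum_{n=1}^\infty\frac{a_n\coth(n\beta;B)-b_n\coth(n\alpha;A)}{n}. \end{aligned}$$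
   Context: Growth conditions $a_k=o(k^c)$ are understood with $|k|^c$ for negative $k$. For a sequence $A=\{a_k\}$ (likewise $B=\{b_k\}$): $D^{(A)}(j):=\sum_{k=1}^\infty\frac{a_k}{k^j}$ for $j>1$. The cotangent function with sequence $A$ is defined by $$\pi\cot(\pi s;A):=\frac{a_0}{s}-2s\sum_{k=1}^\infty\frac{a_k}{k^2-s^2},$$ and the hyperbolic cotangent with sequence $A$ by $\coth(s;A):=i\cot(is;A)$.
   Formalization: The two infinite series on the right may diverge separately when c<1; the identity is proved with both series summed together up to a common cutoff, and literally, with two separate sums, whenever both series converge. *)

(* Defs.v *)
From HB Require Import structures.
From mathcomp Require Import all_boot all_order all_algebra.
From mathcomp Require Import complex.
From mathcomp Require Import all_classical all_reals all_analysis.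

Set Implicit Arguments.
Unset Strict Implicit.
Unset Printing Implicit Defensive.

Import Order.TTheory GRing.Theory Num.Theory.
Import numFieldTopology.Exports numFieldNormedType.Exports.

Local Open Scope classical_set_scope.
Local Open Scope complex_scope.
Local Open Scope ring_scope.

(* [R[i]] gets the topology of its norm: it is a normed module over itself,
   like every [numFieldType], but the concrete type has no such instance in
   the libraries. *)
HB.instance Definition _ (R : realType) := NormedModule.copy R[i] R[i]^o.

(* [A k = o(|k|^c)] as [k -> +oo] and as [k -> -oo]; the second end is read
   along [- k], for which [|- k|^c = k `^ c]. *)
Definition is_o_pow (R : realType) (A : int -> R[i]) (c : R) : Prop :=
  ((fun k : nat => A k%:Z) =o_\oo (fun k : nat => (k%:R `^ c)%:C)) /\
  ((fun k : nat => A (- k%:Z)) =o_\oo (fun k : nat => (k%:R `^ c)%:C)).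

Definition dirichlet (R : realType) (A : int -> R[i]) (j : R) : R[i] :=
  limn (fun N : nat => \sum_(1 <= k < N) A k%:Z / (k%:R `^ j)%:C).

(* The value of [pi * cot (pi * s; A)], as a function of [s]. *)
Definition pi_cot_pi (R : realType) (s : R[i]) (A : int -> R[i]) : R[i] :=
  A 0 / s
    - 2 * s * limn (fun N : nat =>
        \sum_(1 <= k < N) A k%:Z / (k%:R ^+ 2 - s ^+ 2)).

Definition cot_seq (R : realType) (z : R[i]) (A : int -> R[i]) : R[i] :=
  pi_cot_pi (z / pi%:C) A / pi%:C.

Definition coth_seq (R : realType) (z : R[i]) (A : int -> R[i]) : R[i] :=
  'i%C * cot_seq ('i%C * z) A.

(* Main.v *)
(* With U = sum a_k / (beta k^2 - w) and V = sum b_m / (alpha m^2 + w), the left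
   side is a0 b0 / (2 w) + a0 V - b0 U - 2 w U V. Expanding the hyperbolic
   cotangents on the right and using alpha beta = pi^2, everything reduces to
   U V = sum_n (u_n Cb_n + v_n Ca_n), where u and v are the summands of U and V,
   Cb_n = sum_m b_m / (alpha m^2 + beta n^2) and
   Ca_n = sum_k a_k / (beta k^2 + alpha n^2). This is the partial fraction
     1 / (P Q) = (1 / P + 1 / Q) / (P + Q),
     P = beta k^2 - w,  Q = alpha m^2 + w,
   summed over k and m. As c < 1, sum a_k / k^2 and sum b_m / m^2 converge
   absolutely, so the crude bounds alpha m^2 + beta k^2 >= alpha m^2 and
   >= beta k^2 already dominate both double series by a product of absolutely
   convergent series; sums over full rows may then be compared with sums over
   the square k, m < N. *)
Require Import Defs.
From HB Require Import structures.
From mathcomp Require Import all_boot all_order all_algebra.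
From mathcomp Require Import complex ring lra.
From mathcomp Require Import all_classical all_reals all_analysis.

Set Implicit Arguments.
Unset Strict Implicit.
Unset Printing Implicit Defensive.

Import Order.TTheory GRing.Theory Num.Theory.
Import numFieldTopology.Exports numFieldNormedType.Exports.

Local Open Scope classical_set_scope.
Local Open Scope complex_scope.
Local Open Scope ring_scope.

(** * Reduction of complex norms and limits to real ones *)

Lemma normc_real (R : realType) (x : R) : `|x%:C| = `|x|%:C.
Proof. by rewrite normc_def /= expr0n addr0 sqrtr_sqr. Qed.

(** In the partial order of [R[i]] a positive element has zero imaginary part, so every complex
    epsilon is a real one. *)
Lemma gt0_complexE (R : realType) (e : R[i]) : 0 < e ->
  exists2 d : R, 0 < d & e = d%:C.
Proof.
move=> e0; exists (complex.Re e).
  by move: e0; rewrite ltcE => /andP[].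
by rewrite RRe_real // gtr0_real.
Qed.

Lemma normc_ReE (R : realType) (z : R[i]) : `|z| = (complex.Re `|z|)%:C.
Proof. by rewrite RRe_real // normr_real. Qed.

Lemma cvg_real_complex (R : realType) (u : nat -> R) (l : R) :
  u @ \oo --> l -> (fun n => (u n)%:C) @ \oo --> l%:C.
Proof.
move=> /cvgrPdist_lt ul; apply/cvgrPdist_lt => _ /gt0_complexE[d d0 ->].
apply: filterS (ul d d0) => n.
by rewrite -rmorphB normc_real ltcR.
Qed.

Lemma cvgc0_le (R : realType) (f : nat -> R[i]) (t : nat -> R) :
  (forall n, `|f n| <= (t n)%:C) -> t @ \oo --> 0 -> f @ \oo --> 0.
Proof.
move=> ft /cvgr0Pnorm_lt t0; apply/cvgr0Pnorm_lt => _ /gt0_complexE[d d0 ->].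
apply: filterS (t0 d d0) => n tn; apply: le_lt_trans (ft n) _.
by rewrite ltcR (le_lt_trans (ler_norm _)).
Qed.

(** * Absolutely convergent complex series *)

Definition abs_summable (R : realType) (z : nat -> R[i]) : Prop :=
  exists M : R, forall N : nat, \sum_(1 <= k < N) `|z k| <= M%:C.

Lemma cvgn_bounded_sums (R : realType) (r : nat -> R) (M : R) :
  (forall k, 0 <= r k) -> (forall N, \sum_(1 <= k < N) r k <= M) ->
  cvgn (fun N => \sum_(1 <= k < N) r k).
Proof.
move=> r0 rM; apply: nondecreasing_is_cvgn.
  by apply: nondecreasing_series => n _ _; exact: r0.
by exists M => _ [n _ <-]; exact: rM.
Qed.

(** The terms [x k + r k] are nonnegative and at most [2 * r k], so their sums converge; subtracting
    the convergent sums of [r] leaves those of [x]. *)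
Lemma cvgn_dominated_sums (R : realType) (x r : nat -> R) (M : R) :
  (forall k, `|x k| <= r k) -> (forall N, \sum_(1 <= k < N) r k <= M) ->
  cvgn (fun N => \sum_(1 <= k < N) x k).
Proof.
move=> xr rM.
have r0 k : 0 <= r k by exact: le_trans (xr k).
have cr := cvgn_bounded_sums r0 rM.
have cxr : cvgn (fun N => \sum_(1 <= k < N) (x k + r k)).
  apply: (@cvgn_bounded_sums _ _ (M + M)) => [k|N].
    by have := xr k; rewrite ler_norml => /andP[]; lra.
  rewrite big_split lerD //; apply: le_trans (rM N).
  by apply: ler_sum => k _; apply: le_trans (ler_norm _) (xr k).
have -> : (fun N => \sum_(1 <= k < N) x k) =
    (fun N => \sum_(1 <= k < N) (x k + r k) - \sum_(1 <= k < N) r k).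
  by apply/funext => N; rewrite big_split /= addrK.
exact: is_cvgB.
Qed.

Lemma abs_summable_Re (R : realType) (z : nat -> R[i]) : abs_summable z ->
  exists M : R, forall N : nat, \sum_(1 <= k < N) complex.Re `|z k| <= M.
Proof.
case=> M hM; exists M => N; rewrite -lecR rmorph_sum /=.
by under eq_bigr do rewrite -normc_ReE.
Qed.

Lemma abs_summable_cvg (R : realType) (z : nat -> R[i]) : abs_summable z ->
  cvgn (fun N => \sum_(1 <= k < N) z k).
Proof.
move=> /abs_summable_Re[M hM].
have cRe : cvgn (fun N => \sum_(1 <= k < N) complex.Re (z k)).
  apply: cvgn_dominated_sums hM => k.
  by rewrite -lecR -normc_ReE normc_ge_Re.
have cIm : cvgn (fun N => \sum_(1 <= k < N) complex.Im (z k)).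
  apply: cvgn_dominated_sums hM => k; rewrite -lecR -normc_ReE.
  (* The imaginary part of z is the real part of - i z, whose norm is that of z. *)
  have := normc_ge_Re (- 'i%C * z k).
  rewrite normrM normrN (_ : `|'i%C| = 1 :> R[i]) ?mul1r; last first.
    by rewrite normc_def /= expr0n expr1n add0r sqrtr1.
  by rewrite mulNr mulrC raddfN /= ReiNIm opprK.
have -> : (fun N => \sum_(1 <= k < N) z k) =
   (fun N => (\sum_(1 <= k < N) complex.Re (z k))%:C
      + 'i%C * (\sum_(1 <= k < N) complex.Im (z k))%:C).
  apply/funext => N; rewrite !rmorph_sum mulr_sumr -big_split /=.
  by apply: eq_bigr => k _; rewrite -complexE.
apply: is_cvgD.
  by apply/cvg_ex; eexists; apply: cvg_real_complex; exact: cRe.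
apply: is_cvgM; first exact: is_cvg_cst.
by apply/cvg_ex; eexists; apply: cvg_real_complex; exact: cIm.
Qed.

Lemma abs_summable_le (R : realType) (y z : nat -> R[i]) (C : R) : 0 <= C ->
  (\forall k \near \oo, `|z k| <= C%:C * `|y k|) ->
  abs_summable y -> abs_summable z.
Proof.
move=> C0 [K _ hK] [M hM].
have M0 : 0 <= M by have := hM 0; rewrite big_geq // ler0c.
exists (complex.Re (\sum_(1 <= k < K.+1) `|z k|) + C * M) => N.
rewrite rmorphD /= RRe_real ?ger0_real ?sumr_ge0 //.
have [NK|KN] := leqP N K.+1.
  apply: (@le_trans _ _ (\sum_(1 <= k < K.+1) `|z k|)); last first.
    by rewrite lerDl ler0c mulr_ge0.
  case: N NK => [|N] NK; first by rewrite big_geq // sumr_ge0.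
  by rewrite (big_cat_nat _ NK) //= lerDl sumr_ge0.
rewrite (big_cat_nat _ (ltnW KN)) //= lerD2l.
apply: (@le_trans _ _ (\sum_(K.+1 <= k < N) C%:C * `|y k|)).
  by rewrite !big_nat; apply: ler_sum => k /andP[/ltnW Kk _]; exact: hK.
rewrite -mulr_sumr rmorphM /= ler_wpM2l ?ler0c //.
apply: le_trans (hM N).
by rewrite [leRHS](big_cat_nat _ (ltnW KN)) //= lerDr sumr_ge0.
Qed.

(** Here [t N] is the full sum of the norms minus its part below [N]; being uniform in [m], it
    serves to truncate all rows of a double series at once. *)
Lemma abs_summable_tail (R : realType) (z : nat -> R[i]) : abs_summable z ->
  exists2 t : nat -> R, t @ \oo --> 0 &
    forall N m : nat, (0 < N <= m)%N -> \sum_(N <= k < m) `|z k| <= (t N)%:C.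
Proof.
move=> /abs_summable_Re[M hM].
pose r k := complex.Re `|z k|.
have r0 k : 0 <= r k by rewrite -ler0c -normc_ReE.
have cr := cvgn_bounded_sums r0 hM.
exists (fun N => limn (fun N => \sum_(1 <= k < N) r k) - \sum_(1 <= k < N) r k).
  rewrite -[X in _ --> X](subrr (limn (fun N => \sum_(1 <= k < N) r k))).
  by apply: cvgB => //; exact: cvg_cst.
move=> N m /andP[N0 Nm]; under eq_bigr do rewrite normc_ReE.
rewrite -rmorph_sum lecR lerBrDl -big_cat_nat //.
have nd : {homo (fun N => \sum_(1 <= k < N) r k) : n p / (n <= p)%N >-> n <= p}.
  by apply: nondecreasing_series => n _ _; exact: r0.
exact: (nondecreasing_cvgn_le nd cr m).
Qed.

(** * Convergence of the sums of a_k / k^2 *)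

(* Discrete comparison with the integral of x^(-1-s): by ln (1 - x) <= - x,
   (1 - 1/(k+2))^(-s) >= 1 + s/(k+2). *)
Lemma powR_telescope (R : realType) (s : R) (k : nat) : 0 <= s ->
  s * k.+2%:R `^ (- 1 - s) <= k.+1%:R `^ (- s) - k.+2%:R `^ (- s).
Proof.
move=> s0.
have k2 : 0 < k.+2%:R :> R by rewrite ltr0n.
have k1 : 0 < k.+1%:R :> R by rewrite ltr0n.
have qE : k.+1%:R = k.+2%:R * (1 + - k.+2%:R^-1) :> R.
  by rewrite mulrDr mulrN divff ?gt_eqF // mulr1 -[in RHS]addn1 natrD addrK.
have q0 : 0 < 1 + - k.+2%:R^-1 :> R by rewrite -(pmulr_rgt0 _ k2) -qE.
have lnq : ln (1 + - k.+2%:R^-1) <= - k.+2%:R^-1 :> R.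
  by apply: le_ln1Dx; rewrite -subr_gt0 opprK addrC.
have qs : 1 + s / k.+2%:R <= (1 + - k.+2%:R^-1) `^ (- s).
  rewrite /powR gt_eqF //; apply: le_trans (expR_ge1Dx _).
  by rewrite lerD2l mulNr -mulrN ler_wpM2l // lerNr.
have ks : 0 < k.+2%:R `^ (- s) :> R by exact: powR_gt0.
rewrite powRD ?(gt_eqF k2) ?implybT // powR_inv1 ?(ltW k2) //.
rewrite qE powRM ?(ltW k2) ?(ltW q0) //.
rewrite -[X in _ <= _ - X]mulr1 -mulrBr mulrA [leLHS]mulrC.
by rewrite ler_wpM2l ?(ltW ks) // lerBrDl.
Qed.

Lemma riemann_bounded (R : realType) (s : R) : 0 < s ->
  exists M : R, forall N, \sum_(1 <= k < N) k%:R `^ (- 1 - s) <= M.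
Proof.
(* The 1 is the term at k = 1; the telescoping bound gives at most 1 / s for all later terms. *)
move=> s0; exists (1 + s^-1) => -[|N].
  by rewrite big_geq // addr_ge0 // invr_ge0 ltW.
rewrite big_add1 /=; case: N => [|N].
  by rewrite big_geq // addr_ge0 // invr_ge0 ltW.
rewrite big_nat_recl // powR1 lerD2l -[leRHS]mul1r ler_pdivlMr // mulrC mulr_sumr.
apply: (@le_trans _ _ (\sum_(0 <= k < N) (k.+1%:R `^ (- s) - k.+2%:R `^ (- s)))).
  by apply: ler_sum => k _; apply: powR_telescope; exact: ltW.
rewrite (telescope_sumr_eq (fun k => - k.+1%:R `^ (- s))) //; last first.
  by move=> k _; rewrite opprK addrC.
by rewrite opprK powR1 addrC gerBl powR_ge0.
Qed.

(** The terms are eventually at most k^(c - 2) in norm, and c - 2 = - 1 - s with s = 1 - c > 0. *)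
Lemma is_o_pow_summable (R : realType) (A : int -> R[i]) (c : R) :
  c < 1 -> is_o_pow A c ->
  abs_summable (fun k : nat => A k%:Z / k%:R ^+ 2).
Proof.
move=> c1 [/eqoP Ao _].
have [M hM] : exists M : R, forall N, \sum_(1 <= k < N) k%:R `^ (- 1 - (1 - c)) <= M.
  by apply: riemann_bounded; rewrite subr_gt0.
apply: (@abs_summable_le _ (fun k => (k%:R `^ (- 1 - (1 - c)))%:C) _ 1) => //;
  last first.
  exists M => N; under eq_bigr do rewrite normc_real ger0_norm ?powR_ge0 //.
  by rewrite -rmorph_sum lecR.
apply: filterS2 (nbhs_infty_gt 0) (Ao 1 ltr01) => k; rewrite -(ltr0n R) => k0 hk.
rewrite normrM normfV normrX normr_nat.
rewrite -(rmorph_nat (real_complex R)) -rmorphXn -fmorphV /=.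
move: hk; rewrite !mul1r !normc_real => hk.
apply: le_trans (ler_wpM2r _ hk) _; first by rewrite ler0c invr_ge0 exprn_ge0 // ltW.
rewrite -rmorphM lecR !ger0_norm ?powR_ge0 //.
rewrite (_ : -1 - (1 - c) = c - 2%:R); last by lra.
by rewrite powRB ?(gt_eqF k0) ?implybT // powR_mulrn // ltW.
Qed.

(** * Row sums of a dominated double series *)

Lemma limn_mull (R : realType) (x : R[i]) (y : nat -> R[i]) :
  cvgn (fun N => \sum_(1 <= k < N) y k) ->
  limn (fun N => \sum_(1 <= k < N) x * y k) =
    x * limn (fun N => \sum_(1 <= k < N) y k).
Proof.
move=> cy; under eq_fun do rewrite -mulr_sumr.
apply: cvg_lim; first exact: norm_hausdorff.
by apply: cvgM; [exact: cvg_cst|exact: cy].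
Qed.

(** Truncating row k at N costs at most |p_k| T(N), with T a vanishing tail bound for [q]; the first
    N rows together cost at most P |T(N)|, with P a bound for the sums of |p_k|. *)
Lemma row_sums_square (R : realType) (x : nat -> nat -> R[i])
    (p q : nat -> R[i]) :
  abs_summable p -> abs_summable q ->
  (forall k m, (0 < k)%N -> (0 < m)%N -> `|x k m| <= `|p k| * `|q m|) ->
  (fun N => \sum_(1 <= k < N) limn (fun M => \sum_(1 <= m < M) x k m)
    - \sum_(1 <= k < N) \sum_(1 <= m < N) x k m) @ \oo --> 0.
Proof.
move=> [P hP] [Q hQ] xpq.
have P0 : 0 <= P by have := hP 0; rewrite big_geq // ler0c.
have [T T0 hT] : exists2 T : nat -> R, T @ \oo --> 0 &
    forall N m : nat, (0 < N <= m)%N -> \sum_(N <= k < m) `|q k| <= (T N)%:C.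
  by apply: abs_summable_tail; exists Q.
have row k N : (0 < k)%N -> (0 < N)%N ->
    `|limn (fun M => \sum_(1 <= m < M) x k m) - \sum_(1 <= m < N) x k m|
      <= `|p k| * (T N)%:C.
  move=> k0 N0.
  have /cvgrPdist_lt cx : cvgn (fun M => \sum_(1 <= m < M) x k m).
    apply: abs_summable_cvg.
    apply: (@abs_summable_le _ q _ (complex.Re `|p k|)); last by exists Q.
      by rewrite -ler0c -normc_ReE.
    by apply: filterS (nbhs_infty_gt 0) => m m0; rewrite -normc_ReE xpq.
  (* Up to [e], the full row is a partial sum with cutoff [M >= N], whose part from [N] on is
     controlled by the tail of [q]. *)
  apply/ler_addgt0Pr => e e0.
  have [K _ hK] := cx e e0.
  have := hK (maxn K N) (leq_maxl _ _); set M := maxn K N => LM.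
  have NM : (N <= M)%N by exact: leq_maxr.
  rewrite -(subrKA (\sum_(1 <= m < M) x k m)) addrC.
  apply: le_trans (ler_normD _ _) _; apply: lerD; last exact: ltW.
  rewrite (big_cat_nat N0 NM) /= addrAC subrr add0r.
  apply: le_trans (ler_norm_sum _ _ _) _.
  apply: (@le_trans _ _ (\sum_(N <= m < M) `|p k| * `|q m|)).
    rewrite !big_nat; apply: ler_sum => m /andP[Nm _].
    by apply: xpq => //; exact: leq_trans Nm.
  by rewrite -mulr_sumr ler_wpM2l // hT // N0.
apply: (@cvgc0_le _ _ (fun N => P * `|T N|)); last first.
  rewrite -(mulr0 P); apply: cvgM; first exact: cvg_cst.
  by rewrite -(@normr0 _ R); exact: cvg_norm.
case=> [|N].
  by rewrite !big_geq // subrr normr0 ler0c mulr_ge0.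
rewrite -sumrB; apply: le_trans (ler_norm_sum _ _ _) _.
apply: (@le_trans _ _ (\sum_(1 <= k < N.+1) `|p k| * `|T N.+1|%:C)).
  rewrite !big_nat; apply: ler_sum => k /andP[k0 _].
  apply: le_trans (row k N.+1 k0 _) _ => //.
  by rewrite ler_wpM2l // lecR ler_norm.
by rewrite -mulr_suml rmorphM /= ler_wpM2r // ler0c.
Qed.

(** * The cotangents as series with denominators a k^2 - t *)

(* Finitely many zero denominators are harmless: [x / 0 = 0]. *)
Lemma abs_summable_shift (R : realType) (A : nat -> R[i]) (a t : R) : 0 < a ->
  abs_summable (fun k => A k / k%:R ^+ 2) ->
  abs_summable (fun k => A k / (a * k%:R ^+ 2 - t)%:C).
Proof.
move=> a0; apply: (@abs_summable_le _ _ _ (2 / a)).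
  by rewrite divr_ge0 // ltW.
(* For k >= 1 and k >= 2 t / a one has a k^2 >= 2 t, hence a k^2 - t >= a k^2 / 2; this gives the
   constant 2 / a. *)
apply: filterS2 (nbhs_infty_gt 0) (nbhs_infty_ger (2 * t / a)) => k.
rewrite -(ltr0n R) => k0 kt.
have k1 : 1 <= k%:R :> R by rewrite ler1n -(ltr0n R).
have akt : 2 * t <= a * k%:R ^+ 2.
  rewrite -ler_pdivrMl // mulrC; apply: le_trans kt _.
  by rewrite expr2 ler_peMr // ltW.
have ak0 : 0 < a * k%:R ^+ 2 by rewrite mulr_gt0 // exprn_gt0.
have d0 : 0 < a * k%:R ^+ 2 - t by lra.
rewrite !normrM [leRHS]mulrCA ler_wpM2l //.
have -> : k%:R ^+ 2 = (k%:R ^+ 2)%:C :> R[i] by rewrite rmorphXn /= rmorph_nat.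
rewrite -!fmorphV /= !normc_real -rmorphM lecR !gtr0_norm ?invr_gt0 ?exprn_gt0 //.
rewrite -mulrA -invfM -[leLHS]mul1r ler_pdivrMr // mulrAC ler_pdivlMr //.
lra.
Qed.

(** From z^2 = t b and a b = pi^2 follows (z / pi)^2 = t / a, so each denominator k^2 - (z / pi)^2
    equals (a k^2 - t) / a. *)
Lemma cot_seqE (R : realType) (A : int -> R[i]) (a b t : R) (z : R[i]) :
  0 < a -> 0 < b -> a * b = pi ^+ 2 -> z ^+ 2 = (t * b)%:C ->
  abs_summable (fun k : nat => A k%:Z / k%:R ^+ 2) ->
  cot_seq z A = A 0 / z - 2 * z / b%:C
    * limn (fun N => \sum_(1 <= k < N) A k%:Z / (a * k%:R ^+ 2 - t)%:C).
Proof.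
move=> a0 b0 ab z2 sA.
have pi0 : pi%:C != 0 :> R[i] by rewrite fmorph_eq0 gt_eqF // pi_gt0.
have aC0 : a%:C != 0 :> R[i] by rewrite fmorph_eq0 gt_eqF.
have bC0 : b%:C != 0 :> R[i] by rewrite fmorph_eq0 gt_eqF.
have abC : a%:C * b%:C = pi%:C ^+ 2 :> R[i] by rewrite -rmorphM ab rmorphXn.
have zpi : (z / pi%:C) ^+ 2 = t%:C / a%:C.
  by rewrite expr_div_n z2 -abC rmorphM /= -mulf_div divff // mulr1.
rewrite /cot_seq /pi_cot_pi.
have -> : (fun N => \sum_(1 <= k < N) A k%:Z / (k%:R ^+ 2 - (z / pi%:C) ^+ 2))
   = (fun N => \sum_(1 <= k < N) a%:C * (A k%:Z / (a * k%:R ^+ 2 - t)%:C)).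
  apply/funext => N; apply: eq_bigr => k _.
  rewrite zpi mulrCA; congr (_ * _).
  rewrite -[RHS]invf_div rmorphB rmorphM /= rmorphXn /= rmorph_nat.
  by rewrite mulrBl mulrAC divff // mul1r.
rewrite limn_mull; last exact/abs_summable_cvg/abs_summable_shift.
set L := limn _.
rewrite invfM invrK mulrBl; congr (_ - _); first by rewrite mulrA mulfK.
have -> : a%:C = pi%:C ^+ 2 / b%:C :> R[i] by rewrite -abC mulfK.
by move: (pi%:C) (b%:C) pi0 bC0 => p q p0 q0; field; rewrite p0 q0.
Qed.

(** As (i x)^2 = - x^2, this is the cotangent formula at [- t]; the factor i^2 = - 1 turns its
    difference into a sum. *)
Lemma coth_seqE (R : realType) (A : int -> R[i]) (a b t x : R) :
  0 < a -> 0 < b -> a * b = pi ^+ 2 -> x ^+ 2 = t * b ->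
  abs_summable (fun k : nat => A k%:Z / k%:R ^+ 2) ->
  coth_seq x%:C A = A 0 / x%:C + 2 * x%:C / b%:C
    * limn (fun N => \sum_(1 <= k < N) A k%:Z / (a * k%:R ^+ 2 + t)%:C).
Proof.
move=> a0 b0 ab x2 sA.
rewrite /coth_seq (cot_seqE (a := a) (b := b) (t := - t)) //; last first.
  by rewrite exprMn sqr_i -rmorphXn x2 mulN1r mulNr rmorphN.
rewrite opprK; set L := limn _.
have i0 : 'i%C != 0 :> R[i] by rewrite -sqrf_eq0 sqr_i oppr_eq0 oner_eq0.
rewrite mulrBr invfM mulrCA mulVKf //.
suff -> : 'i%C * (2 * ('i%C * x%:C) / b%:C * L) = 'i%C ^+ 2 * (2 * x%:C / b%:C * L).
  by rewrite sqr_i mulN1r opprK.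
by move: ('i%C : R[i]) x%:C => i y; ring.
Qed.

(** * The product of the two series as a single series *)

(** The crude bound for the double series; [s - 0] matches the form of [abs_summable_shift] at shift
    0. *)
Lemma norm_div_shift_le (R : realType) (z : R[i]) (s t : R) :
  0 < s -> 0 <= t -> `|z / (s + t)%:C| <= `|z / (s - 0)%:C|.
Proof.
move=> s0 t0; have st0 : 0 < s + t by rewrite ltr_wpDr.
rewrite subr0 !normrM !normfV !normc_real ler_wpM2l // -!fmorphV lecR.
by rewrite !gtr0_norm // lef_pV2 ?posrE // lerDl.
Qed.

Lemma cvg_double_series (R : realType) (A B : nat -> R[i]) (a b w : R) :
  0 < a -> 0 < b -> 0 < w ->
  (forall n : nat, (0 < n)%N -> b * n%:R ^+ 2 - w != 0) ->
  abs_summable (fun k => A k / k%:R ^+ 2) ->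
  abs_summable (fun k => B k / k%:R ^+ 2) ->
  let u k := A k / (b * k%:R ^+ 2 - w)%:C in
  let v m := B m / (a * m%:R ^+ 2 + w)%:C in
  (fun N => \sum_(1 <= n < N)
    (u n * limn (fun M => \sum_(1 <= m < M)
                   B m / (a * m%:R ^+ 2 + n%:R ^+ 2 * b)%:C)
    + v n * limn (fun M => \sum_(1 <= k < M)
                   A k / (b * k%:R ^+ 2 + n%:R ^+ 2 * a)%:C))) @ \oo -->
  limn (fun N => \sum_(1 <= k < N) u k) * limn (fun N => \sum_(1 <= m < N) v m).
Proof.
move=> a0 b0 w0 bw sA sB u v.
have su : abs_summable u by exact: abs_summable_shift.
have sv : abs_summable v.
  by have := abs_summable_shift (- w) a0 sB; under eq_fun do rewrite opprK.
have shiftD c d (C : nat -> R[i]) : 0 < c -> abs_summable (fun k => C k / k%:R ^+ 2) ->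
    abs_summable (fun k => C k / (c * k%:R ^+ 2 + d)%:C).
  by move=> c0 /(abs_summable_shift (- d) c0); under eq_fun do rewrite opprK.
pose x k m := u k * (B m / (a * m%:R ^+ 2 + k%:R ^+ 2 * b)%:C).
pose y m k := v m * (A k / (b * k%:R ^+ 2 + m%:R ^+ 2 * a)%:C).
have sq0 c (k : nat) : 0 < c -> (0 < k)%N -> 0 < c * k%:R ^+ 2 :> R.
  by move=> c0 k0; rewrite mulr_gt0 // exprn_gt0 // ltr0n.
have hx : (fun N => \sum_(1 <= k < N) limn (fun M => \sum_(1 <= m < M) x k m)
    - \sum_(1 <= k < N) \sum_(1 <= m < N) x k m) @ \oo --> 0.
  apply: row_sums_square su (abs_summable_shift 0 a0 sB) _ => k m k0 m0.
  by rewrite normrM ler_wpM2l // norm_div_shift_le ?sq0 // mulr_ge0 ?sqr_ge0 // ltW.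
have hy : (fun N => \sum_(1 <= m < N) limn (fun M => \sum_(1 <= k < M) y m k)
    - \sum_(1 <= m < N) \sum_(1 <= k < N) y m k) @ \oo --> 0.
  apply: row_sums_square sv (abs_summable_shift 0 b0 sA) _ => m k m0 k0.
  by rewrite normrM ler_wpM2l // norm_div_shift_le ?sq0 // mulr_ge0 ?sqr_ge0 // ltW.
(* The partial fraction: [w] cancels in P + Q, which is the common denominator [D] of [x k m] and
   [y m k]. *)
have xy k m : (0 < k)%N -> (0 < m)%N -> x k m + y m k = u k * v m.
  move=> k0 m0; rewrite /x /y /u /v.
  have hk := bw k k0.
  have hm : a * m%:R ^+ 2 + w != 0 by rewrite gt_eqF // addr_gt0 // sq0.
  have hkm : a * m%:R ^+ 2 + k%:R ^+ 2 * b != 0.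
    by rewrite gt_eqF // addr_gt0 ?sq0 // mulrC sq0.
  have -> : b * k%:R ^+ 2 + m%:R ^+ 2 * a = a * m%:R ^+ 2 + k%:R ^+ 2 * b by ring.
  set D := a * _ + _ in hkm *; set P := b * _ - w in hk *; set Q := _ + w in hm *.
  have DE : D%:C = P%:C + Q%:C.
    by rewrite -rmorphD; congr (_%:C); rewrite /D /P /Q; ring.
  have hP : P%:C != 0 by rewrite fmorph_eq0.
  have hQ : Q%:C != 0 by rewrite fmorph_eq0.
  have : D%:C != 0 by rewrite fmorph_eq0.
  rewrite DE; clearbody P Q; move: (P%:C) (Q%:C) hP hQ => p q p0 q0 pq0.
  by field; rewrite p0 q0 pq0.
have huv : (fun N => (\sum_(1 <= k < N) u k) * (\sum_(1 <= m < N) v m)) @ \oo -->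
    limn (fun N => \sum_(1 <= k < N) u k) * limn (fun N => \sum_(1 <= m < N) v m).
  by apply: cvgM; exact: abs_summable_cvg.
(* By [xy] and an exchange of finite sums, the product of the partial sums is the sum of both square
   sums; these cancel and only the row sums remain. *)
have := cvgD (cvgD hx hy) huv; rewrite !add0r => hlim.
apply: (cvg_trans _ (hlim _ _)); apply: near_eq_cvg; near=> N; rewrite !fctE.
have -> : (\sum_(1 <= k < N) u k) * (\sum_(1 <= m < N) v m) =
    \sum_(1 <= k < N) \sum_(1 <= m < N) x k m
    + \sum_(1 <= m < N) \sum_(1 <= k < N) y m k.
  rewrite [X in _ + X]exchange_big_nat /= -big_split mulr_suml /= !big_nat.
  apply: eq_bigr => k /andP[k0 _].
  rewrite mulr_sumr -big_split /= !big_nat; apply: eq_bigr => m /andP[m0 _].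
  by rewrite xy.
rewrite addrACA !subrK big_split /=; congr (_ + _); apply: eq_bigr => n _.
  by apply: limn_mull; apply: abs_summable_cvg; exact: shiftD.
by apply: limn_mull; apply: abs_summable_cvg; exact: shiftD.
Unshelve. all: by end_near. Qed.

(** * Algebraic expansion of both sides *)

Lemma dirichlet2E (R : realType) (A : int -> R[i]) :
  dirichlet A 2 = limn (fun N => \sum_(1 <= k < N) A k%:Z / k%:R ^+ 2).
Proof.
congr (limn _); apply/funext => N; apply: eq_bigr => k _.
by rewrite powR_mulrn // rmorphXn /= rmorph_nat.
Qed.

(** Meant for a = alpha, b = beta, p = pi, z = sqrt (w alpha), y = sqrt (w beta). Eliminating [b],
    [w] and [y] in favour of [a], [p] and [z] leaves a rational identity. *)
Lemma product_expand (F : numFieldType) (a b p w z y A0 B0 U V : F) :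
  a != 0 -> b != 0 -> z != 0 -> p != 0 ->
  a * b = p ^+ 2 -> z ^+ 2 = w * a -> z * y = w * p ->
  p / 2 * (A0 / z - 2 * z / a * U) * (B0 / y + 2 * y / b * V)
  = A0 * B0 / (2 * w) + A0 * V - B0 * U - 2 * w * (U * V).
Proof.
move=> a0 b0 z0 p0 ab z2 zy.
have bE : b = p ^+ 2 / a by rewrite -ab mulrAC divff // mul1r.
have wE : w = z ^+ 2 / a by rewrite z2 mulfK.
have yE : y = z * p / a.
  by apply: (mulfI z0); rewrite zy wE; field.
by rewrite yE wE bE; field; rewrite a0 z0 p0.
Qed.

(** Adding the summands of both series first gives n b / (w - n^2 b) + 1 / n = w / (n (w - n^2 b))
    and n a / (w + n^2 a) - 1 / n = - w / (n (w + n^2 a)); the parts with [A0] and [B0] then split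
    by partial fractions. *)
Lemma summand_expand (F : numFieldType) (a b w n A0 B0 An Bn Ca Cb : F) :
  a != 0 -> b != 0 -> n != 0 -> a * n ^+ 2 + w != 0 -> b * n ^+ 2 - w != 0 ->
  n * a * (A0 / (n * a) + 2 * (n * a) / a * Ca) / (w + n ^+ 2 * a) * Bn
    + n * b * (B0 / (n * b) + 2 * (n * b) / b * Cb) / (w - n ^+ 2 * b) * An
    + (An * (B0 / (n * b) + 2 * (n * b) / b * Cb)
       - Bn * (A0 / (n * a) + 2 * (n * a) / a * Ca)) / n
  = A0 * (Bn / (a * n ^+ 2 + w)) - B0 * (An / (b * n ^+ 2 - w))
    - A0 / a * (Bn / n ^+ 2) + B0 / b * (An / n ^+ 2)
    - 2 * w * (An / (b * n ^+ 2 - w) * Cb + Bn / (a * n ^+ 2 + w) * Ca).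
Proof.
move=> a0 b0 n0 hp hm.
have -> : w - n ^+ 2 * b = - (b * n ^+ 2 - w) by ring.
have -> : w + n ^+ 2 * a = a * n ^+ 2 + w by ring.
field.
by rewrite a0 b0 n0 hp hm.
Qed.

(** * The identity with a common cutoff and with separate limits *)

(* For [c >= 1/2] the two series of the identity may diverge separately, e.g.
   for [A n = (-1)^n * sqrt |n|] and [B n = sqrt |n|]; only their sum, taken
   with a common cutoff, always converges. Hence the two parts of the
   conclusion: the identity with the two series summed together, and the
   identity with two separate series as soon as both of them converge. *)
Theorem theorem5p7 (R : realType) (A B : int -> R[i])
  (hA : exists2 c : R, c < 1 & is_o_pow A c)
  (hB : exists2 c : R, c < 1 & is_o_pow B c)
  (alpha beta w : R) (alpha_gt0 : 0 < alpha) (beta_gt0 : 0 < beta)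
  (alpha_beta : alpha * beta = pi ^+ 2) (w_gt0 : 0 < w)
  (hw : forall n : nat, (0 < n)%N -> w <> n%:R ^+ 2 * beta) :
  let lhs : R[i] :=
    (pi / 2)%:C * cot_seq (Num.sqrt (w * alpha))%:C A
      * coth_seq (Num.sqrt (w * beta))%:C B in
  let closed : R[i] :=
    A 0 * B 0 / (2 * w)%:C
      + (A 0 * beta%:C * dirichlet B 2 - B 0 * alpha%:C * dirichlet A 2)
        / (pi ^+ 2)%:C in
  let f (n : nat) : R[i] :=
    (n%:R * alpha)%:C * coth_seq (n%:R * alpha)%:C A
        / (w + n%:R ^+ 2 * alpha)%:C * B n%:Z
      + (n%:R * beta)%:C * coth_seq (n%:R * beta)%:C B
        / (w - n%:R ^+ 2 * beta)%:C * A n%:Z in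
  let g (n : nat) : R[i] :=
    (A n%:Z * coth_seq (n%:R * beta)%:C B
      - B n%:Z * coth_seq (n%:R * alpha)%:C A) / n%:R in
  ((fun N : nat =>
      closed + \sum_(1 <= n < N) f n + \sum_(1 <= n < N) g n) @ \oo --> lhs)
  /\ (cvgn (fun N : nat => \sum_(1 <= n < N) f n) ->
      cvgn (fun N : nat => \sum_(1 <= n < N) g n) ->
      lhs = closed + limn (fun N : nat => \sum_(1 <= n < N) f n)
        + limn (fun N : nat => \sum_(1 <= n < N) g n)).
Proof.
move=> lhs closed f g.
have [c1 c1lt oA] := hA; have [c2 c2lt oB] := hB.
have sA := is_o_pow_summable c1lt oA.
have sB := is_o_pow_summable c2lt oB.
have beta_alpha : beta * alpha = pi ^+ 2 by rewrite mulrC.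
have bw n : (0 < n)%N -> beta * n%:R ^+ 2 - w != 0.
  by move=> n0; rewrite subr_eq0; apply/eqP => /esym; rewrite mulrC; exact: hw.
pose u k := A (Posz k) / (beta * k%:R ^+ 2 - w)%:C.
pose v m := B (Posz m) / (alpha * m%:R ^+ 2 + w)%:C.
pose Ca n := limn (fun M => \sum_(1 <= k < M)
  A (Posz k) / (beta * k%:R ^+ 2 + n%:R ^+ 2 * alpha)%:C).
pose Cb n := limn (fun M => \sum_(1 <= m < M)
  B (Posz m) / (alpha * m%:R ^+ 2 + n%:R ^+ 2 * beta)%:C).
pose U := limn (fun N => \sum_(1 <= k < N) u k).
pose V := limn (fun N => \sum_(1 <= m < N) v m).
have hUV := cvg_double_series alpha_gt0 beta_gt0 w_gt0 bw sA sB.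
have cu : (fun N => \sum_(1 <= k < N) u k) @ \oo --> U.
  exact/abs_summable_cvg/abs_summable_shift.
have cv : (fun N => \sum_(1 <= m < N) v m) @ \oo --> V.
  apply: abs_summable_cvg; have := abs_summable_shift (- w) alpha_gt0 sB.
  by under eq_fun do rewrite opprK.
have cA := abs_summable_cvg sA.
have cB := abs_summable_cvg sB.
set DA := limn _ in cA; set DB := limn _ in cB.
have realC0 (x : R) : 0 < x -> x%:C != 0 :> R[i].
  by move=> x0; rewrite fmorph_eq0 gt_eqF.
have aC0 := realC0 _ alpha_gt0; have bC0 := realC0 _ beta_gt0.
have pC0 := realC0 _ (pi_gt0 R); have wC0 := realC0 _ w_gt0.
have abC : alpha%:C * beta%:C = pi%:C ^+ 2 :> R[i].
  by rewrite -rmorphM alpha_beta rmorphXn.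
have wa0 : 0 < w * alpha by rewrite mulr_gt0.
have wb0 : 0 < w * beta by rewrite mulr_gt0.
have lhsE : lhs = A 0 * B 0 / (2 * w)%:C + A 0 * V - B 0 * U
    - 2 * w%:C * (U * V).
  (* The roles are crossed: sqrt (w alpha) has square t b for t = w and b = alpha, so the series of
     [A] has beta k^2 in its denominators. *)
  rewrite /lhs (cot_seqE (a := beta) (b := alpha) (t := w)) //; last first.
    by rewrite -rmorphXn sqr_sqrtr // ltW.
  rewrite (coth_seqE (a := alpha) (b := beta) (t := w)) //; last first.
    by rewrite sqr_sqrtr // ltW.
  rewrite rmorphM fmorphV rmorph_nat [(2 * w)%:C]rmorphM /= rmorph_nat.
  apply: product_expand => //.
  - by rewrite realC0 // sqrtr_gt0.
  - by rewrite -rmorphXn sqr_sqrtr ?rmorphM // ltW.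
  - rewrite -!rmorphM -sqrtrM ?ltW //; congr (_%:C).
    rewrite (_ : w * alpha * (w * beta) = (w * pi) ^+ 2).
      by rewrite sqrtr_sqr ger0_norm // mulr_ge0 ?pi_ge0 // ltW.
    by rewrite exprMn -alpha_beta; ring.
have closedE : closed = A 0 * B 0 / (2 * w)%:C + A 0 / alpha%:C * DB
    - B 0 / beta%:C * DA.
  rewrite /closed !dirichlet2E rmorphXn /= -abC -/DA -/DB.
  move: (alpha%:C) (beta%:C) aC0 bC0 => a b a0 b0.
  by rewrite -!addrA; congr (_ + _); field; rewrite a0 b0.
(* An exact identity at every cutoff: the closed form pairs [DA] and [DB] with their own partial
   sums, so these differences vanish in the limit. *)
have fgE N : closed + \sum_(1 <= n < N) f n + \sum_(1 <= n < N) g n =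
   A 0 * B 0 / (2 * w)%:C
   + A 0 / alpha%:C * (DB - \sum_(1 <= n < N) B n%:Z / n%:R ^+ 2)
   - B 0 / beta%:C * (DA - \sum_(1 <= n < N) A n%:Z / n%:R ^+ 2)
   + A 0 * (\sum_(1 <= n < N) v n) - B 0 * (\sum_(1 <= n < N) u n)
   - 2 * w%:C * \sum_(1 <= n < N) (u n * Cb n + v n * Ca n).
  rewrite -addrA -big_split /= closedE.
  suff -> : \sum_(1 <= n < N) (f n + g n) =
     \sum_(1 <= n < N) (A 0 * v n - B 0 * u n
       - A 0 / alpha%:C * (B n%:Z / n%:R ^+ 2)
       + B 0 / beta%:C * (A n%:Z / n%:R ^+ 2)
       - 2 * w%:C * (u n * Cb n + v n * Ca n)).
    rewrite !(sumrB, big_split) /= -?mulr_sumr.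
    by rewrite !big_split /=; ring.
  rewrite !big_nat; apply: eq_bigr => n /andP[n0 _].
  have nR0 : 0 < n%:R :> R by rewrite ltr0n.
  rewrite /f /g.
  rewrite (coth_seqE (a := beta) (b := alpha) (t := n%:R ^+ 2 * alpha)) //;
    last by ring.
  rewrite (coth_seqE (a := alpha) (b := beta) (t := n%:R ^+ 2 * beta)) //;
    last by ring.
  rewrite -/(Ca n) -/(Cb n) /u /v.
  have hp : alpha * n%:R ^+ 2 + w != 0.
    by rewrite gt_eqF // addr_gt0 // mulr_gt0 // exprn_gt0.
  have hm := bw n n0.
  have nM x : (n%:R * x)%:C = n%:R * x%:C :> R[i] by rewrite rmorphM /= rmorph_nat.
  have n2M x : (n%:R ^+ 2 * x)%:C = n%:R ^+ 2 * x%:C :> R[i].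
    by rewrite rmorphM /= rmorphXn /= rmorph_nat.
  have hpE : (alpha * n%:R ^+ 2 + w)%:C = alpha%:C * n%:R ^+ 2 + w%:C :> R[i].
    by rewrite mulrC rmorphD /= n2M mulrC.
  have hmE : (beta * n%:R ^+ 2 - w)%:C = beta%:C * n%:R ^+ 2 - w%:C :> R[i].
    by rewrite mulrC rmorphB /= n2M mulrC.
  rewrite !nM [(w + _)%:C]rmorphD [(w - _)%:C]rmorphB /= !n2M hpE hmE.
  apply: summand_expand => //.
  - by rewrite pnatr_eq0 -lt0n.
  - by rewrite -hpE fmorph_eq0.
  - by rewrite -hmE fmorph_eq0.
have main : (fun N : nat =>
    closed + \sum_(1 <= n < N) f n + \sum_(1 <= n < N) g n) @ \oo --> lhs.
  under eq_fun do rewrite fgE.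
  (* The zero terms [DB - DB] and [DA - DA] are restored so that the limit can be taken term by
     term. *)
  have -> : lhs = A 0 * B 0 / (2 * w)%:C + A 0 / alpha%:C * (DB - DB)
     - B 0 / beta%:C * (DA - DA) + A 0 * V - B 0 * U - 2 * w%:C * (U * V).
    by rewrite lhsE !subrr !mulr0 addr0 subr0.
  have cst (x : R[i]) : (fun _ : nat => x) @ \oo --> x by exact: cvg_cst.
  apply: cvgB; last by apply: cvgM; [exact: cst|exact: hUV].
  apply: cvgB; last by apply: cvgM; [exact: cst|exact: cu].
  apply: cvgD; last by apply: cvgM; [exact: cst|exact: cv].
  apply: cvgB.
    apply: cvgD; first exact: cst.
    by apply: cvgM; [exact: cst|apply: cvgB; [exact: cst|exact: cB]].
  by apply: cvgM; [exact: cst|apply: cvgB; [exact: cst|exact: cA]].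
split=> // cf cg.
apply: (cvg_unique _ main); first exact: norm_hausdorff.
apply: cvgD; last exact: cg.
by apply: cvgD; [exact: cvg_cst|exact: cf].
Qed.
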